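(* Let $X$ be a finite vertex transitive graph with a core $X_1$ such that $|V(X_1)|=\frac{1}{2}|V(X)|$. Let $\varphi:X\to X_1$ be a retraction onto $X_1$, let $X_2$ be the subgraph of $X$ induced by the vertex set $V(X)\setminus V(X_1)$, and let $Y$ be the bipartite graph (with vertex set $V(X)$ and parts $V(X_1)$, $V(X_2)$) consisting of the edges of $X$ which have exactly one end in each of $V(X_1)$ and $V(X_2)$. Then: \begin{enumerate} \item $X_1\cong X_2$. \item The restriction $\varphi|_{X_2}$ of $\varphi$ to $V(X_2)$ is an isomorphism from $X_2$ to $X_1$. \item $Y$ is regular, and every edge of $Y$ is of the form $\{x,\varphi(y)\}$ where $x,y\in V(X_2)$ are adjacent in $X_2$. \end{enumerate}
   Context: All graphs are finite, undirected and simple (no loops). A graph is vertex transitive if its automorphism group acts transitively on its vertex set. A homomorphism from a graph $X$ to a graph $Y$ is a map $\varphi:V(X)\to V(Y)$ such that $\varphi(x)$ is adjacent to $\varphi(y)$ whenever $x$ is adjacent to $y$. An endomorphism is a homomorphism from a graph to itself. A retraction is an endomorphism that is the identity on its image. A core of a graph $X$ is a subgraph of $X$ with the minimum number of vertices among all subgraphs to which $X$ admits a homomorphism (all cores of $X$ are isomorphic). The notation $X\cong Y$ means that $X$ and $Y$ are isomorphic graphs. *)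

(* Defs.v *)
From mathcomp Require Import all_boot.

Set Implicit Arguments.
Unset Strict Implicit.
Unset Printing Implicit Defensive.

Record sgraph := SGraph {
  vertex :> finType;
  adj : rel vertex;
  adj_sym : symmetric adj;
  adj_irrefl : irreflexive adj }.

Definition is_hom (X Y : sgraph) (f : X -> Y) : Prop :=
  forall x y, adj x y -> adj (f x) (f y).

Definition is_iso (X Y : sgraph) (f : X -> Y) : Prop :=
  bijective f /\ forall x y, adj (f x) (f y) = adj x y.

Definition isomorphic (X Y : sgraph) : Prop := exists f : X -> Y, is_iso f.

Definition vertex_transitive (X : sgraph) : Prop :=
  forall x y : X, exists2 f : X -> X, is_iso f & f x = y.

Definition is_retraction (X : sgraph) (f : X -> X) : Prop :=
  is_hom f /\ {in codom f, forall x, f x = x}.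

(* Subgraphs are not assumed to be induced. *)
Record subgraph (X : sgraph) := Subgraph {
  sverts : {set X};
  sadj : rel X;
  sadj_sub : forall x y,
    sadj x y -> [/\ x \in sverts, y \in sverts & adj x y];
  sadj_sym : symmetric sadj }.

Section SubgraphAsGraph.
Variables (X : sgraph) (S : subgraph X).

Definition subgraph_adj : rel {x : X | x \in sverts S} :=
  fun x y => sadj S (val x) (val y).

Lemma subgraph_adj_sym : symmetric subgraph_adj.
Proof. by move=> x y; apply: sadj_sym. Qed.

Lemma subgraph_adj_irrefl : irreflexive subgraph_adj.
Proof.
move=> x; apply/negP => /sadj_sub[_ _].
by rewrite adj_irrefl.
Qed.

Definition sgraph_of_subgraph : sgraph :=
  SGraph subgraph_adj_sym subgraph_adj_irrefl.

End SubgraphAsGraph.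

Coercion sgraph_of_subgraph : subgraph >-> sgraph.

Definition is_core (X : sgraph) (C : subgraph X) : Prop :=
  (exists f : X -> C, is_hom f) /\
  forall S : subgraph X, (exists f : X -> S, is_hom f) -> #|C| <= #|S|.

(* A retraction onto a subgraph [S] is given with codomain [S], so that it can
   be composed with isomorphisms; [val \o f] is the underlying endomorphism. *)
Definition is_retraction_onto (X : sgraph) (S : subgraph X) (f : X -> S)
    : Prop :=
  [/\ is_hom f, is_retraction (fun x => val (f x) : X)
    & forall s : S, exists x, f x = s].

Section Induced.
Variables (X : sgraph) (A : {set X}).

Definition induced_adj : rel X :=
  fun x y => [&& x \in A, y \in A & adj x y].

Lemma induced_adj_sub x y :
  induced_adj x y -> [/\ x \in A, y \in A & adj x y].
Proof. by case/and3P. Qed.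

Lemma induced_adj_sym : symmetric induced_adj.
Proof. by move=> x y; rewrite /induced_adj adj_sym andbCA. Qed.

Definition induced_subgraph : subgraph X :=
  Subgraph induced_adj_sub induced_adj_sym.

End Induced.

Section EdgesBetween.
Variables (X : sgraph) (A B : {set X}).

Definition between_adj : rel X := fun x y =>
  adj x y && ((x \in A) && (y \in B) || (x \in B) && (y \in A)).

Lemma between_adj_sym : symmetric between_adj.
Proof.
move=> x y; rewrite /between_adj adj_sym.
by rewrite orbC [(x \in B) && _]andbC [(x \in A) && _]andbC.
Qed.

Lemma between_adj_irrefl : irreflexive between_adj.
Proof. by move=> x; rewrite /between_adj adj_irrefl. Qed.

(* All vertices of [X] are kept. For disjoint [A] and [B] the edges are those
   with exactly one end in each of them. *)
Definition edges_between : sgraph :=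
  SGraph between_adj_sym between_adj_irrefl.

End EdgesBetween.

Definition regular (X : sgraph) : Prop :=
  exists k, forall x : X, #|[set y : X | adj x y]| = k.

(* Main.v *)
Require Import Defs.
From mathcomp Require Import all_boot.
From mathcomp Require Import fingroup perm.

(** Let [C] be a core of [X]. By minimality every endomorphism of [C] is
    bijective, hence an automorphism of the finite graph [C]. So for each
    automorphism [g] of [X] and each homomorphism [phi : X -> C], the map
    [phi \o g] restricted to [C] is an automorphism of [C]. This has two
    consequences when [X] is vertex transitive:

    - [C] is vertex transitive, hence regular ([core_vertex_transitive]);
    - every translate [g C] meets each fibre of [phi] in exactly one vertex.
      Averaging over [g] forces all fibres of [phi] to have size
      [#|X| / #|C|] ([card_fibre_core]).

    If [C] is half of [X] and [phi] is a retraction, each fibre thus consists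
    of one vertex of [C] and one vertex outside [C], so that [phi] restricts to
    a bijective homomorphism from [X2], the graph induced outside [C], to [C].
    Since [X] is regular, both halves have the same total degree in [X], and
    the edges across take the same amount from each; hence [X2] has as many
    edges as [C] ([halves_sum_nbrs]) and this bijective homomorphism is an
    isomorphism ([bij_hom_iso]). In particular [X2] is regular of the same
    degree as [C], so [Y] is regular. Finally, if [u] in [C] is adjacent to [v]
    in [X2], write [u = phi y] with [y] in [X2]; then [phi v] is adjacent to
    [phi u = u = phi y], and the isomorphism reflects this to an edge between
    [v] and [y]. *)

Set Implicit Arguments.
Unset Strict Implicit.
Unset Printing Implicit Defensive.

(** * Degrees and isomorphisms *)

Definition degree (X : sgraph) (x : X) := #|[set y : X | adj x y]|.

Definition arcs (X : sgraph) := [set p : X * X | adj p.1 p.2].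

Lemma card_arcs (X : sgraph) : #|arcs X| = \sum_(x : X) degree x.
Proof.
rewrite -sum1_card (eq_bigl (fun p : X * X => true && adj p.1 p.2)); last first.
  by move=> p; rewrite inE.
rewrite -(pair_big_dep xpredT (fun x y => adj x y) (fun _ _ => 1)) /=.
apply: eq_bigr => x _; rewrite /degree -sum1_card.
by apply: eq_bigl => y; rewrite inE.
Qed.

Lemma degree_iso (X Y : sgraph) (f : X -> Y) (x : X) :
  is_iso f -> degree (f x) = degree x.
Proof.
case=> bijf adjf; have injf := bij_inj bijf; case: bijf => g _ gK.
rewrite /degree -(card_imset _ injf); apply: eq_card => y.
rewrite inE; apply/idP/imsetP => [fxy | [z]].
  by exists (g y); rewrite ?gK // inE -adjf gK.
by rewrite inE -adjf => fxz ->.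
Qed.

Lemma vertex_transitive_regular (X : sgraph) :
  vertex_transitive X -> exists k, forall x : X, degree x = k.
Proof.
move=> HX; case: (pickP X) => [x0 _ | X0]; last first.
  by exists 0 => x; have := X0 x.
by exists (degree x0) => x; have [f isof <-] := HX x0 x; rewrite degree_iso.
Qed.

Lemma iso_sym (X Y : sgraph) : isomorphic X Y -> isomorphic Y X.
Proof.
case=> f [[g fK gK] adjf]; exists g; split; first by exists f.
by move=> x y; rewrite -adjf !gK.
Qed.

(** A bijective homomorphism embeds the arcs of [X] into those of [Y]; as the
    numbers of arcs agree, it cannot create an adjacency. *)
Lemma bij_hom_iso (X Y : sgraph) (f : X -> Y) :
  is_hom f -> injective f -> #|X| = #|Y| -> #|arcs X| = #|arcs Y| -> is_iso f.
Proof.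
move=> homf injf cardXY cardA; split.
  by apply: inj_card_bij => //; rewrite cardXY.
pose ff (p : X * X) := (f p.1, f p.2).
have injff : injective ff by move=> [a b] [c d] [/injf-> /injf->].
have imA : ff @: arcs X = arcs Y.
  apply/eqP; rewrite eqEcard card_imset // cardA leqnn andbT.
  by apply/subsetP => _ /imsetP[p + ->]; rewrite !inE => /homf.
move=> x y; apply/idP/idP => [fxy | /homf //].
have : (f x, f y) \in arcs Y by rewrite inE.
by rewrite -imA => /imsetP[[a b]]; rewrite inE => /= ? [/injf-> /injf->].
Qed.

(** * Averaging over the automorphisms *)

Definition automorphisms (X : sgraph) : {set {perm X}} :=
  [set g : {perm X} | [forall x, forall y, adj (g x) (g y) == adj x y]].

Lemma automorphismP (X : sgraph) (g : {perm X}) :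
  reflect (forall x y, adj (g x) (g y) = adj x y) (g \in automorphisms X).
Proof.
rewrite inE; apply: (iffP forallP) => [H x y | H x].
  by have /forallP/(_ y)/eqP := H x.
by apply/forallP => y; rewrite H.
Qed.

Lemma vertex_transitive_perm (X : sgraph) :
  vertex_transitive X ->
  forall x y : X, exists2 g, g \in automorphisms X & g x = y.
Proof.
move=> HX x y; have [f [bijf adjf] fxy] := HX x y.
exists (perm (bij_inj bijf)); last by rewrite permE.
by apply/automorphismP => a b; rewrite !permE.
Qed.

Definition movers (X : sgraph) (x y : X) :=
  [set g in automorphisms X | g x == y].

(** Composing with automorphisms on both sides moves the pair [(x, y)] to any
    other pair; this is the constancy of the size of the cosets of a point
    stabiliser. *)
Lemma leq_card_movers (X : sgraph) : vertex_transitive X ->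
  forall x y x' y' : X, #|movers x y| <= #|movers x' y'|.
Proof.
move=> /vertex_transitive_perm HX x y x' y'.
have [h hA hx'] := HX x' x; have [k kA ky] := HX y y'.
pose t (g : {perm X}) := (h * g * k)%g.
have injt : injective t by move=> a b /mulIg/mulgI.
rewrite -(card_imset _ injt); apply/subset_leq_card/subsetP.
move=> _ /imsetP[g + ->]; rewrite inE => /andP[gA /eqP gx].
rewrite inE !permM hx' gx ky eqxx andbT.
by apply/automorphismP => a b; rewrite !permM !(automorphismP _ _).
Qed.

(** For fixed [x], the images [g x] are uniformly distributed over [X]; so an
    automorphism sends on average [#|S| * #|F| / #|X|] elements of [S] into
    [F], and this average is one here. *)
Lemma card_mul_translates (X : sgraph) (S F : {set X}) :
  vertex_transitive X ->
  (forall g, g \in automorphisms X -> #|[set x in S | g x \in F]| = 1) ->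
  #|S| * #|F| = #|X|.
Proof.
move=> HX meet1; set A := automorphisms X.
have idA : 1%g \in A by apply/automorphismP => a b; rewrite !permE.
(* The value at the identity shows that [S] is not empty. *)
have /eqP/cards1P[x0 S1] := meet1 _ idA.
set c := #|movers x0 x0|.
have cE (x y : X) : #|movers x y| = c.
  by apply/eqP; rewrite eqn_leq !(leq_card_movers HX).
have c_gt0 : 0 < c.
  by apply/card_gt0P; exists 1%g; rewrite inE idA permE /= eqxx.
have cardA (B : {set X}) (x : X) : #|[set g in A | g x \in B]| = #|B| * c.
  rewrite -sum1_card (partition_big (fun g : {perm X} => g x) (mem B)) /=.
    rewrite -sum_nat_const; apply: eq_bigr => y yB; rewrite -(cE x y) sum1_card.
    apply: eq_card => g; rewrite unfold_in !inE -andbA.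
    by case: (g x =P y) => [->|_]; rewrite ?yB ?andbF ?andbT.
  by move=> g; rewrite inE => /andP[_ gxB].
have cardAX : #|A| = #|X| * c.
  by rewrite -cardsT -(cardA setT x0); apply: eq_card => g; rewrite !inE andbT.
apply/eqP; rewrite -(eqn_pmul2r c_gt0) -cardAX -mulnA; apply/eqP.
rewrite -sum_nat_const -[RHS]sum1_card.
under [RHS]eq_bigr => g gA do rewrite -(meet1 g gA) -sum1_card.
rewrite (exchange_big_dep (mem S)) /=; last first.
  by move=> g x _; rewrite inE => /andP[].
apply: eq_bigr => x xS; rewrite -(cardA F x) -sum1_card.
by apply: eq_bigl => g; rewrite !inE xS.
Qed.

(** * Cores *)

Lemma card_subgraph (X : sgraph) (S : subgraph X) : #|S| = #|sverts S|.
Proof. by rewrite card_sig; apply: eq_card. Qed.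

Section Core.
Variables (X : sgraph) (C : subgraph X).
Hypothesis coreC : is_core C.

(** The vertices hit by an endomorphism of [C] span a graph to which [X] maps,
    so there are at least [#|C|] of them. *)
Lemma core_endo_inj (f : C -> C) : is_hom f -> injective f.
Proof.
move=> homf; case: coreC => [[r homr] minC].
pose D := induced_subgraph [set val (f x) | x in C].
have inD x : val (f x) \in sverts D by apply/imsetP; exists x.
have leCD : #|C| <= #|D|.
  apply: minC; exists (fun x => exist _ (val (f (r x))) (inD (r x))) => x y xy.
  rewrite /= /subgraph_adj /= /induced_adj !inD /=.
  by have /homf/sadj_sub[_ _] := homr _ _ xy.
have injfv : injective (fun x : C => val (f x)).
  apply/injectiveP/card_uniqP; rewrite size_map -cardE.
  apply/eqP; rewrite eqn_leq leq_image_card /=.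
  apply: leq_trans leCD _; rewrite card_subgraph.
  by apply/subset_leq_card/subsetP => y /imsetP[x _ ->]; apply: codom_f.
by move=> x y fxy; apply: injfv; rewrite /= fxy.
Qed.

Lemma core_endo_iso (f : C -> C) : is_hom f -> is_iso f.
Proof. by move=> homf; apply: bij_hom_iso => //; apply: core_endo_inj. Qed.

(** An automorphism [g] of [X] need not preserve [C]; composing with [phi]
    brings the translate [g C] back and gives an automorphism of [C]. *)
Lemma core_translate_iso (phi : X -> C) (g : X -> X) :
  is_hom phi -> is_hom g -> is_iso (fun x : C => phi (g (val x))).
Proof.
move=> homphi homg; apply: core_endo_iso => x y /sadj_sub[_ _ xy].
exact/homphi/homg.
Qed.

(** Some automorphism [g] of [X] takes [x] to any prescribed vertex of [C], but
    [r] may then move that vertex. As [r] permutes [C], it suffices to aim [g]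
    at the preimage of [y]. *)
Lemma core_vertex_transitive : vertex_transitive X -> vertex_transitive C.
Proof.
move=> HX x y; case: coreC => [[r homr] _].
have [[s _ sK] _] := core_translate_iso homr (fun _ _ => id).
have [g [_ adjg] gx] := HX (val x) (val (s y)).
exists (fun z : C => r (g (val z))); last by rewrite gx sK.
by apply: (core_translate_iso homr) => a b; rewrite adjg.
Qed.

(** By [core_translate_iso], each translate of [C] is a transversal of the
    fibres of [phi], so the averaging argument applies. *)
Lemma card_fibre_core (phi : X -> C) (v : C) :
  vertex_transitive X -> is_hom phi ->
  #|C| * #|[set x | phi x == v]| = #|X|.
Proof.
move=> HX homphi; rewrite card_subgraph.
apply: card_mul_translates => // g /automorphismP adjg.
have homg : is_hom (g : X -> X) by move=> a b; rewrite adjg.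
have [[s sK Ks] _] := core_translate_iso homphi homg.
rewrite -(cards1 (val (s v))); apply: eq_card => x; rewrite !inE.
apply/andP/eqP => [[xC /eqP phix] | ->].
  by have /(congr1 val) /= := sK (exist _ x xC); rewrite phix => ->.
by rewrite Ks; split=> //; apply: valP.
Qed.

End Core.

(** * Splitting the vertices into two halves *)

Definition nbrs_in (X : sgraph) (A : {set X}) (x : X) :=
  #|[set y in A | adj x y]|.

Lemma degree_split (X : sgraph) (A : {set X}) (x : X) :
  degree x = nbrs_in A x + nbrs_in (~: A) x.
Proof.
rewrite /degree -(cardsID A); congr (_ + _); apply: eq_card => y.
  by rewrite !inE andbC.
by rewrite !inE.
Qed.

Lemma sum_nbrs_across (X : sgraph) (A B : {set X}) :
  \sum_(x in A) nbrs_in B x = \sum_(x in B) nbrs_in A x.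
Proof.
rewrite /nbrs_in; under eq_bigr => x _ do rewrite -sum1_card.
under [RHS]eq_bigr => x _ do rewrite -sum1_card.
rewrite (exchange_big_dep (mem B)) /=; last first.
  by move=> x y _; rewrite inE => /andP[].
apply: eq_bigr => y yB; apply: eq_bigl => x.
by rewrite !inE yB /= adj_sym.
Qed.

(** Both halves have the same total degree, and the edges across contribute
    equally to the two. *)
Lemma halves_sum_nbrs (X : sgraph) (k : nat) (A : {set X}) :
  (forall x : X, degree x = k) -> #|A| = #|~: A| ->
  \sum_(x in A) nbrs_in A x = \sum_(x in ~: A) nbrs_in (~: A) x.
Proof.
move=> regX cardA.
have total (B : {set X}) :
    \sum_(x in B) nbrs_in A x + \sum_(x in B) nbrs_in (~: A) x = #|B| * k.
  rewrite -big_split -sum_nat_const; apply: eq_bigr => x _ /=.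
  by rewrite -degree_split regX.
have := total (~: A); rewrite -cardA -(total A) sum_nbrs_across addnC.
by move/addIn.
Qed.

Definition is_induced (X : sgraph) (S : subgraph X) :=
  forall x y : S, adj x y = adj (val x) (val y).

Lemma induced_subgraph_is_induced (X : sgraph) (A : {set X}) :
  is_induced (induced_subgraph A).
Proof.
by move=> x y; rewrite /= /subgraph_adj /= /induced_adj !(valP x, valP y).
Qed.

(** A subgraph may omit edges between its vertices, but the retraction maps
    every such edge of [X] to itself, so it lies in [S]. *)
Lemma retract_is_induced (X : sgraph) (S : subgraph X) (r : X -> S) :
  is_hom r -> (forall x : S, r (val x) = x) -> is_induced S.
Proof.
move=> homr rK x y; apply/idP/idP => [/sadj_sub[] // | /homr].
by rewrite !rK.
Qed.

Lemma degree_induced (X : sgraph) (S : subgraph X) (x : S) :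
  is_induced S -> degree x = nbrs_in (sverts S) (val x).
Proof.
move=> indS; rewrite /degree /nbrs_in -(card_imset _ val_inj).
apply: eq_card => y; rewrite inE; apply/imsetP/andP => [[z] | [yS xy]].
  by rewrite inE indS => xz ->; split=> //; apply: valP.
by exists (exist _ y yS) => //; rewrite inE indS.
Qed.

Lemma card_arcs_induced (X : sgraph) (S : subgraph X) : is_induced S ->
  #|arcs S| = \sum_(x in sverts S) nbrs_in (sverts S) x.
Proof.
move=> indS; rewrite card_arcs.
under eq_bigr => x _ do rewrite degree_induced //.
by rewrite -(big_sub (sverts S)).
Qed.

(** * Retractions onto half of the vertices *)

Unset Implicit Arguments.

Theorem theorem2p1 (X : sgraph) (X1 : subgraph X) (phi : X -> X1)
    (HX : vertex_transitive X)
    (HX1 : is_core X1)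
    (Hcard : 2 * #|X1| = #|X|)
    (Hphi : is_retraction_onto phi) :
  let X2 : subgraph X := induced_subgraph (~: sverts X1) in
  let Y : sgraph := edges_between (sverts X1) (sverts X2) in
  [/\ isomorphic X1 X2,
      is_iso ((fun x => phi (val x)) : X2 -> X1)
    & regular Y /\
      forall u v : Y, adj u v ->
        exists x y : X2,
          adj x y /\ [set u; v] = [set val x; val (phi (val y))] :> {set X}].
Proof.
move=> X2 Y; set A := sverts X1.
have [homphi [_ phi_fix] phi_onto] := Hphi.
have phiK (x : X1) : phi (val x) = x.
  have [z <-] := phi_onto x; apply: val_inj.
  by apply: (phi_fix (val (phi z))); apply: (codom_f (fun x => val (phi x))).
have ind1 : is_induced X1 := retract_is_induced homphi phiK.
have ind2 : is_induced X2 := @induced_subgraph_is_induced _ _.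
have card1 : #|X1| = #|A| := card_subgraph X1.
have card2 : #|X2| = #|~: A| := card_subgraph X2.
have cardA : #|A| = #|~: A|.
  by apply: (@addnI #|A|); rewrite cardsC -card1 addnn -mul2n.
have [k regX] := vertex_transitive_regular HX.
have [d reg1] := vertex_transitive_regular (core_vertex_transitive HX1 HX).
have inj2 : injective ((fun x => phi (val x)) : X2 -> X1).
  move=> x y eq_phi; apply: val_inj; apply/eqP/negPn/negP => neq_xy.
  set v := phi (val x) in eq_phi.
  have fibre2 : #|[set z | phi z == v]| = 2.
    have card_gt0 : 0 < #|X1| by apply/card_gt0P; exists v.
    apply/eqP; rewrite -(eqn_pmul2l card_gt0) card_fibre_core //.
    by rewrite -Hcard mulnC.
  have vA : val v \in A := valP v.
  have xA : val x \notin A by have := valP x; rewrite inE.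
  have yA : val y \notin A by have := valP y; rewrite inE.
  (* The fibre over [v] would contain [v], [x] and [y]. *)
  have : #|[set val v; val x; val y]| <= 2.
    rewrite -fibre2; apply/subset_leq_card/subsetP => z.
    by rewrite !inE => /orP[/orP[]|] /eqP->; rewrite ?phiK -?eq_phi.
  rewrite -setUA cardsU1 cards2 neq_xy !inE negb_or.
  by rewrite (memPn xA) // (memPn yA).
have iso2 : is_iso ((fun x => phi (val x)) : X2 -> X1).
  apply: bij_hom_iso => //; first by move=> x y; rewrite ind2; apply: homphi.
    by rewrite card1 card2.
  by rewrite !card_arcs_induced // -(halves_sum_nbrs regX).
split=> //; first by apply: iso_sym; exists (fun x : X2 => phi (val x)).
split.
  (* Each vertex has [d] of its [k] neighbours on its own side. *)
  exists (k - d) => u; rewrite -(regX u) (degree_split A u).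
  have [uA | uA] := boolP (u \in A).
    rewrite -(reg1 (exist _ u uA)) degree_induced //= addKn.
    by apply: eq_card => v; rewrite !inE /between_adj !inE uA /= orbF andbC.
  have uA2 : u \in ~: A by rewrite inE.
  rewrite -(reg1 (phi u)).
  rewrite (degree_iso (exist _ u uA2 : X2) iso2) degree_induced //= addnK.
  by apply: eq_card => v; rewrite !inE /between_adj !inE (negPf uA) /= andbC.
have [[s sK Ks] adj2] := iso2.
(* In an edge across, [phi] fixes the end [u] in [X1] and moves [v] into [X1];
   [iso2] pulls the resulting edge of [X1] back to [X2]. *)
have half u v : adj u v -> u \in A -> v \notin A ->
    exists x y : X2,
      adj x y /\ [set u; v] = [set val x; val (phi (val y))] :> {set X}.
  move=> uv uA; rewrite -in_setC => vA.
  pose u1 : X1 := exist _ u uA; exists (exist _ v vA : X2), (s u1).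
  rewrite Ks setUC; split=> //; rewrite -adj2 Ks -(phiK u1) /=.
  by apply: homphi; rewrite adj_sym.
move=> u v /andP[uv]; rewrite !inE.
case/orP=> /andP[]; first exact: half.
by rewrite setUC => uA vA; apply: half => //; rewrite adj_sym.
Qed.
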